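(* Let $s\in(0,n)$ be an integer, let $f\colon\mathbb{R}^n\to\mathbb{R}$, $g=(g_1,\dots,g_p)\colon\mathbb{R}^n\to\mathbb{R}^p$, $h=(h_1,\dots,h_q)\colon\mathbb{R}^n\to\mathbb{R}^q$ be of class $C^1$, and let $\Phi=\{x\in\mathbb{R}^n:g_i(x)\le0,\ i=1,\dots,p,\ h_j(x)=0,\ j=1,\dots,q\}$, $\mathcal S=\{x\in\mathbb{R}^n:\|x\|_0\le s\}$ and $\Omega=\Phi\cap\mathcal S$. Let $\bar x\in\Omega$, suppose that $f$, $g$ and $h$ are of class $C^{1,1}$ around $\bar x$, and let $\bar x$ be an S-stationary point with $(\bar\lambda,\bar\mu)\in\Lambda^S(\bar x)$. If for every $u\in[T_\Omega(\bar x)\cap\mathcal C(\bar x)]\setminus\{0_{\mathbb{R}^n}\}$ and for any $z\in\partial^2L(\bar x,\bar\lambda,\bar\mu)(u)$ one has $\langle z,u\rangle>0$, then $\bar x$ is an isolated local solution of order $2$ of the problem of minimizing $f$ over $\Omega$.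
   Context: Notation: $\|x\|_0$ is the number of nonzero components of $x$; $I(\bar x)=\{i\in\{1,\dots,p\}:g_i(\bar x)=0\}$. The point $\bar x\in\Omega$ is an isolated local solution of order $2$ if there are $c>0$ and a neighborhood $U$ of $\bar x$ with $f(x)\ge f(\bar x)+\frac12c\|x-\bar x\|^2$ for all $x\in\Omega\cap U$. A real function is of class $C^{1,1}$ around $\bar x$ if on some open neighborhood of $\bar x$ it is Fréchet differentiable with locally Lipschitz gradient; for vector-valued maps this is required of each component. The cone of critical directions at $\bar x$ is $\mathcal C(\bar x)=\{u\in\mathbb{R}^n:\langle\nabla f(\bar x),u\rangle=0,\ \langle\nabla g_i(\bar x),u\rangle\le0,\ i\in I(\bar x),\ \langle\nabla h_j(\bar x),u\rangle=0,\ j=1,\dots,q\}$. For $X\subset\mathbb{R}^n$ and $\bar x\in X$, the contingent cone is $T_X(\bar x)=\{u:\exists t_k\to0^+,\ \exists u_k\to u,\ \bar x+t_ku_k\in X\ \forall k\}$. The Fréchet normal cone is $\widehat N_X(\bar x)=\{v:\limsup_{x\to\bar x,\,x\in X}\langle v,x-\bar x\rangle/\|x-\bar x\|\le0\}$, and the limiting normal cone $N_X(\bar x)$ is the set of all limits of sequences $v_k\in\widehat N_X(x_k)$ with $x_k\to\bar x$, $x_k\in X$. Lagrangian and multipliers: $L(x,\lambda,\mu)=f(x)+\langle\lambda,g(x)\rangle+\langle\mu,h(x)\rangle$ for $x\in\mathbb{R}^n$, $\lambda\in\mathbb{R}^p_+$, $\mu\in\mathbb{R}^q$; $\Lambda^S(\bar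 x)=\{(\lambda,\mu)\in\mathbb{R}^p_+\times\mathbb{R}^q:-\nabla_xL(\bar x,\lambda,\mu)\in\widehat N_{\mathcal S}(\bar x),\ \lambda_ig_i(\bar x)=0,\ i=1,\dots,p\}$. The point $\bar x$ is S-stationary if $\Lambda^S(\bar x)\neq\emptyset$. For $\psi$ of class $C^{1,1}$ around $\bar x$, the limiting (Mordukhovich) second-order subdifferential is $\partial^2\psi(\bar x)(u)=\{w\in\mathbb{R}^n:(w,-u)\in N_{\mathrm{gph}\,\nabla\psi}(\bar x,\nabla\psi(\bar x))\}$, which equals $\partial\langle u,\nabla\psi\rangle(\bar x)$, where $\partial\varphi(\bar x)=\{v:(v,-1)\in N_{\mathrm{epi}\,\varphi}(\bar x,\varphi(\bar x))\}$ is the limiting subdifferential. $\partial^2L(\bar x,\bar\lambda,\bar\mu)(u)$ means $\partial^2\psi(\bar x)(u)$ for $\psi=L(\cdot,\bar\lambda,\bar\mu)$. *)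

(* Defs.v *)
From HB Require Import structures.
From mathcomp Require Import all_boot all_order all_algebra.
From mathcomp Require Import all_classical all_reals all_analysis.

Set Implicit Arguments.
Unset Strict Implicit.
Unset Printing Implicit Defensive.

Import Order.TTheory GRing.Theory Num.Theory.
Import numFieldNormedType.Exports.

Local Open Scope classical_set_scope.
Local Open Scope ring_scope.

(* R^n is 'rV[R]_n.  The library equips it with the product topology and the
   sup norm `|x|.  [enorm] is the Euclidean norm; it is used wherever a norm is
   written below.  Limits, neighbourhoods, differentiability and local Lipschitz
   continuity are the library's: they do not depend on which of two equivalent
   norms is chosen. *)
Definition dotv (R : realType) (n : nat) (x y : 'rV[R]_n) : R :=
  \sum_(i < n) x ord0 i * y ord0 i.

Definition enorm (R : realType) (n : nat) (x : 'rV[R]_n) : R :=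
  Num.sqrt (dotv x x).

Definition l0norm (R : realType) (n : nat) (x : 'rV[R]_n) : nat :=
  #|[pred i : 'I_n | x ord0 i != 0]|.

(* The row vector representing the Frechet differential 'd f x with respect to
   [dotv]; a junk value where f is not differentiable. *)
Definition grad (R : realType) (n : nat) (f : 'rV[R]_n -> R) (x : 'rV[R]_n)
    : 'rV[R]_n :=
  \row_(i < n) 'd f x (delta_mx ord0 i).

Definition comp (R : realType) (n m : nat) (g : 'rV[R]_n -> 'rV[R]_m)
    (i : 'I_m) : 'rV[R]_n -> R :=
  fun x => g x ord0 i.

Definition C1 (R : realType) (n : nat) (f : 'rV[R]_n -> R) : Prop :=
  (forall x, differentiable f x) /\ continuous (grad f).

Definition C1_vec (R : realType) (n m : nat) (g : 'rV[R]_n -> 'rV[R]_m)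
    : Prop :=
  forall i : 'I_m, C1 (comp g i).

Definition C11_around (R : realType) (n : nat) (f : 'rV[R]_n -> R)
    (xbar : 'rV[R]_n) : Prop :=
  exists U : set 'rV[R]_n,
    [/\ open U, U xbar,
        forall x, U x -> differentiable f x
      & forall x, U x ->
          exists2 V, nbhs x V & [lipschitz grad f y | y in V]].

Definition C11_vec_around (R : realType) (n m : nat)
    (g : 'rV[R]_n -> 'rV[R]_m) (xbar : 'rV[R]_n) : Prop :=
  forall i : 'I_m, C11_around (comp g i) xbar.

Definition isolated_local_solution2 (R : realType) (n : nat)
    (f : 'rV[R]_n -> R) (Omega : set 'rV[R]_n) (xbar : 'rV[R]_n) : Prop :=
  Omega xbar /\
  exists c : R, 0 < c /\
  exists U : set 'rV[R]_n, nbhs xbar U /\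
    forall x, (Omega `&` U) x ->
      f x >= f xbar + 2^-1 * c * enorm (x - xbar) ^+ 2.

Definition contingent_cone (R : realType) (n : nat) (X : set 'rV[R]_n)
    (xbar : 'rV[R]_n) : set 'rV[R]_n :=
  [set u | exists (t : nat -> R) (v : nat -> 'rV[R]_n),
     [/\ (forall k, 0 < t k), t @ \oo --> (0 : R), v @ \oo --> u
       & forall k, X (xbar + t k *: v k)]].

(* The upper limit is over x in X with x <> xbar; if xbar is isolated in X, it
   is -oo and every vector is normal. *)
Definition frechet_normal (R : realType) (n : nat) (X : set 'rV[R]_n)
    (xbar : 'rV[R]_n) : set 'rV[R]_n :=
  [set v | (limf_esup
      (fun x : 'rV[R]_n => (dotv v (x - xbar) / enorm (x - xbar))%:E)
      (within X xbar^') <= 0)%E].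

Definition limiting_normal (R : realType) (n : nat) (X : set 'rV[R]_n)
    (xbar : 'rV[R]_n) : set 'rV[R]_n :=
  [set v | exists (x w : nat -> 'rV[R]_n),
     [/\ (forall k, X (x k)), x @ \oo --> xbar,
         (forall k, frechet_normal X (x k) (w k)) & w @ \oo --> v]].

(* R^n x R^n is identified with 'rV[R]_(n + n) through [row_mx]. *)
Definition graph (R : realType) (n : nat) (F : 'rV[R]_n -> 'rV[R]_n)
    : set 'rV[R]_(n + n) :=
  [set row_mx x (F x) | x in [set: 'rV[R]_n]].

Definition subdiff2 (R : realType) (n : nat) (psi : 'rV[R]_n -> R)
    (xbar u : 'rV[R]_n) : set 'rV[R]_n :=
  [set w | limiting_normal (graph (grad psi)) (row_mx xbar (grad psi xbar))
             (row_mx w (- u))].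

Definition feasible (R : realType) (n p q : nat) (g : 'rV[R]_n -> 'rV[R]_p)
    (h : 'rV[R]_n -> 'rV[R]_q) : set 'rV[R]_n :=
  [set x | (forall i : 'I_p, comp g i x <= 0) /\
           (forall j : 'I_q, comp h j x = 0)].

Definition sparse (R : realType) (n s : nat) : set 'rV[R]_n :=
  [set x | (l0norm x <= s)%N].

Arguments sparse {R n} s.

Definition active (R : realType) (n p : nat) (g : 'rV[R]_n -> 'rV[R]_p)
    (xbar : 'rV[R]_n) : set 'I_p :=
  [set i | comp g i xbar = 0].

Definition critical_cone (R : realType) (n p q : nat) (f : 'rV[R]_n -> R)
    (g : 'rV[R]_n -> 'rV[R]_p) (h : 'rV[R]_n -> 'rV[R]_q) (xbar : 'rV[R]_n)
    : set 'rV[R]_n :=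
  [set u | [/\ dotv (grad f xbar) u = 0,
     (forall i : 'I_p, active g xbar i -> dotv (grad (comp g i) xbar) u <= 0)
   & (forall j : 'I_q, dotv (grad (comp h j) xbar) u = 0)]].

Definition lagrangian (R : realType) (n p q : nat) (f : 'rV[R]_n -> R)
    (g : 'rV[R]_n -> 'rV[R]_p) (h : 'rV[R]_n -> 'rV[R]_q)
    (lambda : 'rV[R]_p) (mu : 'rV[R]_q) : 'rV[R]_n -> R :=
  fun x => f x + dotv lambda (g x) + dotv mu (h x).

Definition multipliersS (R : realType) (n p q s : nat) (f : 'rV[R]_n -> R)
    (g : 'rV[R]_n -> 'rV[R]_p) (h : 'rV[R]_n -> 'rV[R]_q) (xbar : 'rV[R]_n)
    : set ('rV[R]_p * 'rV[R]_q) :=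
  [set lm : 'rV[R]_p * 'rV[R]_q | [/\ (forall i, 0 <= lm.1 ord0 i),
     frechet_normal (sparse s) xbar
       (- grad (lagrangian f g h lm.1 lm.2) xbar)
   & (forall i, lm.1 ord0 i * comp g i xbar = 0)]].

Definition S_stationary (R : realType) (n p q s : nat) (f : 'rV[R]_n -> R)
    (g : 'rV[R]_n -> 'rV[R]_p) (h : 'rV[R]_n -> 'rV[R]_q) (xbar : 'rV[R]_n)
    : Prop :=
  multipliersS s f g h xbar !=set0.

(* Main.v *)
(* Let L be the Lagrangian and F its gradient.  If xbar is not an isolated local
   solution of order 2, there are feasible sparse points x = xbar + t u with
   enorm u = 1, t -> 0 and f x < f xbar + o(t^2).  Hence L x <= L xbar + o(t^2),
   and, since -F(xbar) is normal to the sparse set, <F xbar, u> >= 0.  The mean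
   value theorem along the segment gives tau in (0, t) with
   <u, F (xbar + tau u) - F xbar> <= o(1) tau.  An approximate mean value theorem
   for the Lipschitz function phi = <u, F .> turns this into a proximal
   subgradient w of phi at some y close to xbar with <w, u> <= o(1), and then
   (w, -u) is a Frechet normal to the graph of F at y.  As w is bounded by the
   Lipschitz constant of F, a limit (z, ubar) of the pairs (w, u) satisfies
   z \in d^2 L(xbar)(ubar) and <z, ubar> <= 0, while ubar is a nonzero critical
   tangent direction: a contradiction. *)
Require Import Defs.
From HB Require Import structures.
From mathcomp Require Import all_boot all_order all_algebra.
From mathcomp Require Import all_classical all_reals all_analysis.
From mathcomp Require Import ring lra.
Import Order.TTheory GRing.Theory Num.Theory.
Import numFieldNormedType.Exports.
Local Open Scope classical_set_scope.
Local Open Scope ring_scope.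

(** * Euclidean geometry of row vectors *)

Section dot_product.
Context {R : realType} {n : nat}.
Implicit Types x y z : 'rV[R]_n.

Lemma dotvC x y : dotv x y = dotv y x.
Proof. by apply: eq_bigr => i _; rewrite mulrC. Qed.

Lemma dotvDl x y z : dotv (x + y) z = dotv x z + dotv y z.
Proof. by rewrite -big_split; apply: eq_bigr => i _; rewrite mxE mulrDl. Qed.

Lemma dotvZl k x y : dotv (k *: x) y = k * dotv x y.
Proof. by rewrite mulr_sumr; apply: eq_bigr => i _; rewrite mxE mulrA. Qed.

Lemma dotvDr x y z : dotv x (y + z) = dotv x y + dotv x z.
Proof. by rewrite dotvC dotvDl !(dotvC x). Qed.

Lemma dotvZr k x y : dotv x (k *: y) = k * dotv x y.
Proof. by rewrite dotvC dotvZl dotvC. Qed.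

Lemma dotvNl x y : dotv (- x) y = - dotv x y.
Proof. by rewrite -scaleN1r dotvZl mulN1r. Qed.

Lemma dotvNr x y : dotv x (- y) = - dotv x y.
Proof. by rewrite dotvC dotvNl dotvC. Qed.

Lemma dotvBl x y z : dotv (x - y) z = dotv x z - dotv y z.
Proof. by rewrite dotvDl dotvNl. Qed.

Lemma dotvBr x y z : dotv x (y - z) = dotv x y - dotv x z.
Proof. by rewrite dotvDr dotvNr. Qed.

Lemma dotv0r x : dotv x 0 = 0.
Proof. by rewrite -(scale0r x) dotvZr mul0r. Qed.

Lemma dotv_sqrD x y :
  dotv (x + y) (x + y) = dotv x x + 2 * dotv x y + dotv y y.
Proof. by rewrite !(dotvDl, dotvDr) (dotvC y x); ring. Qed.

Lemma dotv_suml (I : Type) (r : seq I) (P : pred I) (F : I -> 'rV[R]_n) y :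
  dotv (\sum_(i <- r | P i) F i) y = \sum_(i <- r | P i) dotv (F i) y.
Proof.
have h0 : dotv 0 y = 0 by rewrite dotvC dotv0r.
exact: (big_morph (fun a => dotv a y) (fun a b => dotvDl a b y) h0).
Qed.

Lemma dotv_ge0 x : 0 <= dotv x x.
Proof. by apply: sumr_ge0 => i _; rewrite -expr2 sqr_ge0. Qed.

Lemma dotv_eq0 x : (dotv x x == 0) = (x == 0).
Proof.
apply/eqP/eqP => [|->]; last exact: dotv0r.
move/eqP; rewrite psumr_eq0 => [|i _]; last by rewrite -expr2 sqr_ge0.
move=> /allP x0; apply/rowP => i; rewrite mxE.
by have := x0 i (mem_index_enum i); rewrite -expr2 sqrf_eq0 => /eqP.
Qed.

Lemma enorm_ge0 x : 0 <= enorm x.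
Proof. exact: sqrtr_ge0. Qed.

Lemma sqr_enorm x : enorm x ^+ 2 = dotv x x.
Proof. by rewrite sqr_sqrtr// dotv_ge0. Qed.

Lemma enormZ k x : enorm (k *: x) = `|k| * enorm x.
Proof.
by rewrite /enorm dotvZl dotvZr mulrA -expr2 sqrtrM ?sqr_ge0// sqrtr_sqr.
Qed.

Lemma enorm0 : enorm (0 : 'rV[R]_n) = 0.
Proof. by rewrite /enorm dotv0r sqrtr0. Qed.

(** Cauchy-Schwarz: for y nonzero, the squared length of <y,y> x - <x,y> y is <y,y> (<x,x> <y,y> -
    <x,y>^2), and it is nonnegative. *)
Lemma dotv_sqr_le x y : dotv x y ^+ 2 <= dotv x x * dotv y y.
Proof.
have [->|y0] := eqVneq y 0; first by rewrite !dotv0r expr0n mulr0.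
have : 0 < dotv y y by rewrite lt_def dotv_eq0 y0 dotv_ge0.
have := dotv_ge0 (dotv y y *: x - dotv x y *: y).
rewrite !(dotvBl, dotvBr, dotvZl, dotvZr) (dotvC y x).
move: (dotv x x) (dotv y y) (dotv x y) => a b c h b0.
by rewrite -(ler_pM2l b0); nra.
Qed.

Lemma dotv_le_enorm x y : `|dotv x y| <= enorm x * enorm y.
Proof.
rewrite -(@ler_pXn2r _ 2)// ?nnegrE ?mulr_ge0 ?enorm_ge0//.
by rewrite exprMn !sqr_enorm real_normK ?num_real// dotv_sqr_le.
Qed.

Lemma ler_enormD x y : enorm (x + y) <= enorm x + enorm y.
Proof.
rewrite -(@ler_pXn2r _ 2)// ?nnegrE ?addr_ge0 ?enorm_ge0//.
rewrite sqrrD !sqr_enorm dotv_sqrD; have := dotv_le_enorm x y.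
by rewrite ler_norml => /andP[_]; lra.
Qed.

Lemma ler_norm_coord x i : `|x ord0 i| <= `|x|.
Proof.
rewrite [leRHS]/Num.Def.normr/= mx_normrE; apply/bigmax_geP.
by right; exists (ord0, i).
Qed.

Lemma norm_le_enorm x : `|x| <= enorm x.
Proof.
rewrite [leLHS]/Num.Def.normr/= mx_normrE; apply/bigmax_leP; split=> [|[i j] _] /=.
  exact: enorm_ge0.
rewrite (ord1 i) -(@ler_pXn2r _ 2)// ?nnegrE ?enorm_ge0//.
rewrite sqr_enorm real_normK ?num_real// /dotv (bigD1 j)//= -expr2 lerDl.
by apply: sumr_ge0 => k _; rewrite -expr2 sqr_ge0.
Qed.

Lemma dotv_le_norm x y : `|dotv x y| <= n%:R * `|x| * `|y|.
Proof.
apply: (le_trans (ler_norm_sum _ _ _)).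
rewrite -mulrA mulr_natl -[X in _ *+ X]card_ord -sumr_const.
by apply: ler_sum => i _; rewrite normrM ler_pM ?ler_norm_coord.
Qed.

Lemma enorm_le_norm x : enorm x <= n%:R * `|x|.
Proof.
rewrite -(@ler_pXn2r _ 2)// ?nnegrE ?mulr_ge0 ?enorm_ge0//.
rewrite sqr_enorm (le_trans (ler_norm _))// (le_trans (dotv_le_norm _ _))//.
rewrite exprMn -mulrA -expr2 ler_wpM2r ?sqr_ge0// -natrX ler_nat.
by case: (n) => // k; rewrite leq_pmulr.
Qed.

Lemma enorm_gt0 x : x != 0 -> 0 < enorm x.
Proof. by move=> x0; rewrite (lt_le_trans _ (norm_le_enorm x))// normr_gt0. Qed.

Lemma near_enorm_lt x (e : R) : 0 < e -> \forall z \near x, enorm (z - x) < e.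
Proof.
(* The successor keeps the divisor positive when n = 0. *)
move=> e0; have d0 : 0 < e / n.+1%:R by rewrite divr_gt0.
near=> z; apply: (le_lt_trans (enorm_le_norm _)).
have : `|z - x| < e / n.+1%:R.
  by rewrite distrC; near: z; exact: cvgr_dist_lt.
rewrite ltr_pdivlMr// -natr1; have := normr_ge0 (z - x); lra.
Unshelve. all: by end_near. Qed.

Lemma nbhs_enormP x (P : set 'rV[R]_n) :
  nbhs x P -> exists2 r : R, 0 < r & forall z, enorm (z - x) < r -> P z.
Proof.
move=> /nbhs_ballP[r /= r0 rP]; exists r => // z zx; apply: rP.
by rewrite mx_norm_ball /ball_/= distrC (le_lt_trans (norm_le_enorm _)).
Qed.

Lemma dotv_cvg (T : Type) (F : set_system T) {FF : Filter F}
    (a b : T -> 'rV[R]_n) (x y : 'rV[R]_n) :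
  a @ F --> x -> b @ F --> y -> (fun t => dotv (a t) (b t)) @ F --> dotv x y.
Proof.
have coord_cvg (c : T -> 'rV[R]_n) z i :
    c @ F --> z -> (fun t => c t ord0 i) @ F --> z ord0 i.
  by move=> cz; exact: cvg_comp cz (@coord_continuous R 1 n ord0 i z).
move=> ax by_; apply: cvg_big => [|i _]; first exact: add_continuous.
by apply: cvgM; exact: coord_cvg.
Qed.

End dot_product.

Lemma dotv_row_mx {R : realType} {n m : nat} (a c : 'rV[R]_n) (b d : 'rV[R]_m) :
  dotv (row_mx a b) (row_mx c d) = dotv a c + dotv b d.
Proof.
rewrite /dotv big_split_ord/=; congr +%R; apply: eq_bigr => i _.
  by rewrite !row_mxEl.
by rewrite !row_mxEr.
Qed.

Lemma norm_le_compact {R : realType} {n : nat} (A : set 'rV[R]_n) (M : R) :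
  closed A -> (forall y, A y -> `|y| <= M) -> compact A.
Proof.
move=> Acl AM; apply: bounded_closed_compact => //.
exists M; split; first exact: num_real.
by move=> c Mc y Ay; apply: (le_trans (AM y Ay)); exact: ltW.
Qed.

(** * Proximal subgradients *)

Definition proximal_subgradient {R : realType} {n : nat} (phi : 'rV[R]_n -> R)
    (y w : 'rV[R]_n) : Prop :=
  exists B : R, 0 <= B /\ \forall z \near y,
    phi y + dotv w (z - y) - B * dotv (z - y) (z - y) <= phi z.

(* With s the coordinate along [u] and N the squared distance to [x], minimise
   phi - A s + (M + J) / 2 N - J / 2 s^2 over the half ball {N <= r^2, s >= 0}.
   Here M is large enough to exclude minimisers on the sphere, and J, which
   penalises the distance to the line through [x] along [u], to exclude them on
   the face s = 0; so the minimiser y is interior.  The J-terms cancel in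
   direction [u], whence <w, u> = A - M s y <= A. *)
Lemma fuzzy_mean_value {R : realType} {n : nat} (phi : 'rV[R]_n -> R)
    (x u : 'rV[R]_n) (K r A T : R) :
  enorm u = 1 -> 0 <= K -> 0 < A -> 0 < T <= r -> 2 * (K + A) * T <= A * r ->
  continuous phi ->
  (forall y : 'rV[R]_n, enorm (y - x) <= r ->
     phi x - K * enorm (y - x) <= phi y) ->
  phi (x + T *: u) - phi x < A / 2 * T ->
  exists y w, [/\ enorm (y - x) < r, dotv w u <= A &
                  proximal_subgradient phi y w].
Proof.
move=> u1 K0 A0 /andP[T0 Tr] ATr phi_cont phi_low phiT.
have r0 : 0 < r by exact: lt_le_trans Tr.
have uu : dotv u u = 1 by rewrite -sqr_enorm u1 expr1n.
(* On the sphere of radius r the term M N / 2 equals (K + A) r, which offsets both the largest drop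
   K r of [phi] and the largest value A r of A s. *)
pose M := 2 * (K + A) / r.
have Mr : M * r = 2 * (K + A) by rewrite /M divfK// gt_eqF.
have M0 : 0 < M by rewrite /M divr_gt0// mulr_gt0// ltr_wpDl.
(* Since M T <= A, the trial point x + T u brings [G] below [phi x] by at least this amount. *)
pose gap := A / 2 * T - (phi (x + T *: u) - phi x).
have gap0 : 0 < gap by rewrite subr_gt0.
(* With this value J (J e^2 - 2 K e + gap) = (J e - K)^2 + J e^2 (J - J), that is, the perfect
   square (J e - K)^2; hence [G] stays above [phi x - gap] on the face s = 0. *)
pose J := K ^+ 2 / gap.
have J0 : 0 <= J by rewrite /J divr_ge0 ?sqr_ge0// ltW.
have Jgap : J * gap = K ^+ 2 by rewrite /J divfK// gt_eqF.
pose s (y : 'rV[R]_n) := dotv u (y - x).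
pose N (y : 'rV[R]_n) := dotv (y - x) (y - x).
pose G y := phi y - A * s y + (M + J) / 2 * N y - J / 2 * s y ^+ 2.
have sN y : s y ^+ 2 <= N y.
  by have := dotv_sqr_le u (y - x); rewrite uu mul1r.
have xE : (x + T *: u) - x = T *: u by rewrite addrC addKr.
have s1 : s (x + T *: u) = T by rewrite /s xE dotvZr uu mulr1.
have N1 : N (x + T *: u) = T ^+ 2.
  by rewrite /N xE dotvZr dotvZl uu mulr1 expr2.
have G1 : G (x + T *: u) <= phi x - gap.
  rewrite /G s1 N1 /gap -subr_ge0.
  have MT : M * T <= A.
    by rewrite -(ler_pM2r r0) mulrAC Mr.
  have : 0 <= (A - M * T) * T by rewrite mulr_ge0 ?subr_ge0// ltW.
  lra.
have sub_cvg (y : 'rV[R]_n) : (fun z => z - x) @ nbhs y --> y - x.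
  by apply: cvgB; [exact: cvg_id|exact: cvg_cst].
have s_cont : continuous s.
  move=> y; apply: (@dotv_cvg _ _ _ (nbhs y) _ (fun=> u) (fun z => z - x)) => //.
  exact: cvg_cst.
have N_cont : continuous N.
  move=> y.
  by apply: (@dotv_cvg _ _ _ (nbhs y) _ (fun z => z - x) (fun z => z - x)).
have G_cont : continuous G.
  have cM (k : R) (f : 'rV[R]_n -> R) : continuous f ->
      continuous (fun z => k * f z).
    by move=> fc y; apply: (@cvgMl_tmp _ _ (nbhs y)); exact: fc.
  have s2 : continuous (fun z => s z ^+ 2).
    by move=> y; apply: (cvgM (s_cont y) (s_cont y)).
  move=> y; apply: (cvgB (cvgD (cvgB (phi_cont y) (cM A _ s_cont y))
    (cM ((M + J) / 2) _ N_cont y)) (cM (J / 2) _ s2 y)).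
pose D := (N @^-1` [set v | v <= r ^+ 2]) `&` (s @^-1` [set v | 0 <= v]).
have enorm_le y c : 0 <= c -> (N y <= c ^+ 2) = (enorm (y - x) <= c).
  by move=> c0; rewrite /N -sqr_enorm ler_pXn2r// nnegrE// enorm_ge0.
have D_compact : compact D.
  apply: (@norm_le_compact _ _ _ (r + `|x|)) => [|y []].
    apply: closedI.
      by apply: preimage_closed; [move=> y _; exact: N_cont|exact: closed_le].
    by apply: preimage_closed; [move=> y _; exact: s_cont|exact: closed_ge].
  rewrite /= (enorm_le _ _ (ltW r0)) => yr _.
  rewrite -[y in leLHS](subrK x) (le_trans (ler_normD _ _))// lerD2r.
  exact: le_trans (norm_le_enorm _) yr.
have D1 : D (x + T *: u).
  by split; rewrite /= ?s1 ?N1 ?(ltW T0)// ler_pXn2r// nnegrE ltW.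
have [y /set_mem[/= Nyr sy0] ymin] := EVT_min_rV
  (ex_intro _ _ D1) D_compact (continuous_subspaceT G_cont).
have {}Gy : G y <= phi x - gap by rewrite (le_trans (ymin _ (mem_set D1))).
have yr : enorm (y - x) <= r by rewrite -(enorm_le _ _ (ltW r0)).
have := phi_low _ yr; set e := enorm (y - x) => phiy.
have e0 : 0 <= e by exact: enorm_ge0.
have NyE : N y = e ^+ 2 by rewrite /e sqr_enorm.
have sy_gt0 : 0 < s y.
  rewrite lt_neqAle sy0 andbT eq_sym; apply/eqP => s0.
  move: Gy; rewrite /G s0 NyE; apply/negP; rewrite -ltNge.
  have Me : 0 <= M * e ^+ 2 by rewrite mulr_ge0 ?sqr_ge0// ltW.
  (* The square argument divides by J. If J = 0 then K = 0, and [phi y >= phi x] is already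
     contradictory. *)
  have [Jz|Jnz] := eqVneq J 0.
    have K00 : K = 0 by apply/eqP; rewrite -sqrf_eq0 -Jgap Jz mul0r.
    move: phiy; rewrite K00 Jz; lra.
  have Jp : 0 < J by rewrite lt_def Jnz.
  have : 0 <= J * (J * e ^+ 2 - 2 * K * e + gap).
    by rewrite mulrDr Jgap; have := sqr_ge0 (J * e - K); lra.
  rewrite pmulr_rge0//; lra.
have Ny_lt : N y < r ^+ 2.
  rewrite lt_neqAle Nyr andbT; apply/eqP => Ny.
  have er : e = r by apply/eqP; rewrite -(@eqrXn2 _ 2)// ?(ltW r0)// -NyE Ny.
  have syr : s y <= r by rewrite -(@ler_pXn2r _ 2)// ?nnegrE ?(ltW r0)// -Ny sN.
  move: Gy; rewrite /G Ny; apply/negP; rewrite -ltNge.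
  have Asy : 0 <= A * (r - s y) by rewrite mulr_ge0 ?subr_ge0// ltW.
  have Jsy : 0 <= J * (r ^+ 2 - s y ^+ 2) by rewrite mulr_ge0// subr_ge0 -Ny sN.
  have MrE : M * r ^+ 2 = 2 * (K + A) * r by rewrite -Mr; ring.
  move: phiy; rewrite er; lra.
(* The vector is minus the gradient at y of the smooth function [G - phi]. *)
exists y, (A *: u - (M + J) *: (y - x) + (J * s y) *: u); split.
- by rewrite -(@ltr_pXn2r _ 2)// ?nnegrE ?enorm_ge0 ?(ltW r0)// sqr_enorm.
- rewrite dotvDl dotvBl !dotvZl uu (dotvC (y - x)) -/(s y).
  have : 0 <= M * s y by rewrite mulr_ge0// ltW.
  lra.
(* With d = z - y, the quadratic part of [G - phi] is (M + J) / 2 |d|^2 - J / 2 <u, d>^2, whose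
   second term has the favourable sign. *)
- exists ((M + J) / 2); split; first by rewrite divr_ge0// addr_ge0// ltW.
  near=> z.
  have zD : D z.
    split; apply: ltW; near: z.
      by apply: (cvgr_lt (N y)) => //; exact: N_cont.
    by apply: (cvgr_gt (s y)) => //; exact: s_cont.
  have := ymin z (mem_set zD); rewrite /G.
  have zE : z - x = (y - x) + (z - y) by rewrite [RHS]addrC subrKA.
  have -> : N z = N y + 2 * dotv (y - x) (z - y) + dotv (z - y) (z - y).
    by rewrite /N zE dotv_sqrD.
  have -> : s z = s y + dotv u (z - y) by rewrite /s zE dotvDr.
  move: (z - y) (y - x) => d c; rewrite dotvDl dotvBl !dotvZl.
  have := mulr_ge0 J0 (sqr_ge0 (dotv u d)); lra.
Unshelve. all: by end_near. Qed.

(** * Frechet normals *)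

(** The upper limit is an infimum of suprema over members of the filter: a value below e provides a
    member where f <= e, and conversely the set {f <= e} is itself such a member. Only [Filter F] is
    assumed, so the empty punctured neighbourhood of an isolated point is covered. *)
Lemma limf_esup_fin_le0 {R : realType} {T : choiceType} {X : filteredType T}
    (f : X -> R) (F : set_system X) : Filter F ->
  (limf_esup (fun x => (f x)%:E) F <= 0)%E <->
  (forall e : R, 0 < e -> \forall x \near F, f x <= e).
Proof.
move=> FF; split=> [f0 e e0|fe].
  have /ereal_inf_lt[_ [A FA <-] Ae] :
      (limf_esup (fun x => (f x)%:E) F < e%:E)%E.
    by rewrite (le_lt_trans f0)// lte_fin.
  apply: filterS FA => x Ax; rewrite -lee_fin (le_trans _ (ltW Ae))//.
  by apply: ereal_sup_ubound; exists x.
apply/lee_addgt0Pr => e e0; rewrite add0e; apply: ge_ereal_inf.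
exists (ereal_sup [set (f x)%:E | x in [set x | f x <= e]]).
  by exists [set x | f x <= e] => //; exact: fe.
by apply: ge_ereal_sup => _ [x /= fx <-]; rewrite lee_fin.
Qed.

(** Clearing the denominator also removes the puncture, since both sides vanish at y = x. *)
Lemma frechet_normalP {R : realType} {n : nat} (X : set 'rV[R]_n)
    (x v : 'rV[R]_n) :
  frechet_normal X x v <->
  forall e : R, 0 < e -> \forall y \near x, X y ->
    dotv v (y - x) <= e * enorm (y - x).
Proof.
rewrite /frechet_normal /= limf_esup_fin_le0; split=> H e e0.
  have := H e e0; rewrite /dnbhs !near_withinE; apply: filterS => y Hy Xy.
  have [->|yx] := eqVneq y x; first by rewrite subrr dotv0r enorm0 mulr0.
  by rewrite -ler_pdivrMr ?Hy// enorm_gt0// subr_eq0.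
rewrite /dnbhs !near_withinE; have := H e e0; apply: filterS => y Hy yx Xy.
by rewrite ler_pdivrMr ?Hy// enorm_gt0// subr_eq0.
Qed.

Lemma line_cvg {R : realType} {n : nat} (x d : 'rV[R]_n) :
  x + h *: d @[h --> 0^'+] --> x.
Proof.
apply: cvg_at_right_filter; rewrite -[X in _ --> X]addr0 -(scale0r d).
by apply: cvgD; [exact: cvg_cst|apply: cvgZr_tmp; exact: cvg_id].
Qed.

(** A step h w from y raises [phi] by at least h |w|^2 - B h^2 |w|^2 and by at most K h |w|; for
    small h > 0 this rules out |w| > K. *)
Lemma proximal_subgradient_norm_le {R : realType} {n : nat}
    (phi : 'rV[R]_n -> R) (y w : 'rV[R]_n) (K : R) :
  0 <= K -> (\forall z \near y, phi z <= phi y + K * enorm (z - y)) ->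
  proximal_subgradient phi y w -> enorm w <= K.
Proof.
move=> K0 phiK [B [B0 phiB]]; rewrite leNgt; apply/negP => Kw.
have w0 : 0 < enorm w by exact: le_lt_trans Kw.
suff : \forall h \near (0 : R)^'+, False.
  by move=> /filter_ex[].
near=> h.
have h0 : 0 < h by near: h; exact: nbhs_right_gt.
(* The threshold ensures B h |w| < |w| - K; using B + 1 keeps the divisor positive when B = 0. *)
have hB : h < (enorm w - K) / ((B + 1) * enorm w).
  near: h; apply: nbhs_right_lt.
  by rewrite divr_gt0 ?subr_gt0// mulr_gt0// ltr_wpDl.
have upper : phi (y + h *: w) <= phi y + K * enorm (y + h *: w - y).
  by near: h; exact: (line_cvg y w _ phiK).
have : phi y + dotv w (y + h *: w - y)
    - B * dotv (y + h *: w - y) (y + h *: w - y) <= phi (y + h *: w).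
  by near: h; exact: (line_cvg y w _ phiB).
move=> /le_trans /(_ upper).
have -> : y + h *: w - y = h *: w by rewrite addrC addKr.
rewrite enormZ (gtr0_norm h0) !(dotvZl, dotvZr) -sqr_enorm.
have Bw : 0 < (B + 1) * enorm w by rewrite mulr_gt0// ltr_wpDl.
move: hB; rewrite ltr_pdivlMr//.
move=> hB le1.
have : (h * enorm w) * (enorm w - B * h * enorm w - K) <= 0 by lra.
rewrite pmulr_rle0 ?mulr_gt0//; have := mulr_gt0 h0 w0; lra.
Unshelve. all: by end_near. Qed.

(** Along the graph, the product of (w, -u) with the increment is <w, z - y> - <u, F z - F y> <= B
    |z - y|^2. This is small compared with the increment of the graph point, whose norm is at least
    |z - y|. *)
Lemma proximal_subgradient_frechet_normal {R : realType} {n : nat}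
    (F : 'rV[R]_n -> 'rV[R]_n) (y u w : 'rV[R]_n) :
  proximal_subgradient (fun z => dotv u (F z)) y w ->
  frechet_normal (graph F) (row_mx y (F y)) (row_mx w (- u)).
Proof.
move=> [B [B0 prox]]; apply/frechet_normalP => e e0.
have lsub_cvg : lsubmx v @[v --> row_mx y (F y)] --> y.
  have := @continuous_lsubmx R 1 n n (row_mx y (F y)).
  by rewrite /continuous_at row_mxKl.
have eB : 0 < e / (B + 1) by rewrite divr_gt0// ltr_wpDl.
near=> v => -[z _ zv].
have Hz1 : dotv u (F y) + dotv w (lsubmx v - y) -
    B * dotv (lsubmx v - y) (lsubmx v - y) <= dotv u (F (lsubmx v)).
  by near: v; exact: (lsub_cvg _ prox).
have : enorm (lsubmx v - y) < e / (B + 1).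
  by near: v; exact: (lsub_cvg _ (near_enorm_lt y _ eB)).
move: Hz1; rewrite -zv row_mxKl => Hz1.
rewrite ltr_pdivlMr ?ltr_wpDl// => Hz2.
have {}Hz2 : B * enorm (z - y) <= e by have := enorm_ge0 (z - y); lra.
rewrite opp_row_mx add_row_mx dotv_row_mx dotvNl (dotvBr u).
set N := enorm _.
have zN : enorm (z - y) <= N.
  rewrite -(@ler_pXn2r _ 2)// ?nnegrE ?enorm_ge0//.
  by rewrite !sqr_enorm dotv_row_mx lerDl dotv_ge0.
rewrite (@le_trans _ _ (B * enorm (z - y) * enorm (z - y)))//.
  by move: Hz1; rewrite -mulrA -expr2 sqr_enorm; lra.
by rewrite ler_pM ?enorm_ge0// mulr_ge0// enorm_ge0.
Unshelve. all: by end_near. Qed.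

(** * Gradients and the Lagrangian *)

Lemma diffE_grad {R : realType} {n : nat} (f : 'rV[R]_n -> R)
    (x v : 'rV[R]_n) : 'd f x v = dotv (grad f x) v.
Proof.
rewrite [in LHS](row_sum_delta v) linear_sum dotvC.
by apply: eq_bigr => i _; rewrite linearZ mxE.
Qed.

Lemma grad_unique {R : realType} {n : nat} (f df : 'rV[R]_n -> R)
    (x v : 'rV[R]_n) : is_diff x f df -> (forall u, df u = dotv v u) ->
  grad f x = v.
Proof.
move=> fdf dfE; apply/rowP => i; rewrite mxE diff_val dfE.
rewrite /dotv (bigD1 i)//= big1 => [|j /negbTE ji]; rewrite !mxE !eqxx /=.
  by rewrite mulr1 addr0.
by rewrite ji mulr0.
Qed.

Section lagrangian_gradient.
Context {R : realType} {n p q : nat}.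
Variables (f : 'rV[R]_n -> R) (g : 'rV[R]_n -> 'rV[R]_p)
  (h : 'rV[R]_n -> 'rV[R]_q) (lambda : 'rV[R]_p) (mu : 'rV[R]_q).
Hypotheses (f_diff : forall x : 'rV[R]_n, differentiable f x)
  (g_diff : forall i (x : 'rV[R]_n), differentiable (Defs.comp g i) x)
  (h_diff : forall j (x : 'rV[R]_n), differentiable (Defs.comp h j) x).

(** The explicit formula lets continuity and Lipschitz estimates be proved term by term. *)
Definition grad_lagrangian (x : 'rV[R]_n) : 'rV[R]_n :=
  grad f x + (\sum_(i < p) lambda ord0 i *: grad (Defs.comp g i) x
              + \sum_(j < q) mu ord0 j *: grad (Defs.comp h j) x).

Lemma dotv_comp_is_diff m (k : 'rV[R]_n -> 'rV[R]_m) (a : 'rV[R]_m)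
    (x : 'rV[R]_n) :
  (forall i, differentiable (Defs.comp k i) x) ->
  is_diff x (fun y => dotv a (k y))
    (dotv (\sum_(i < m) a ord0 i *: grad (Defs.comp k i) x)).
Proof.
move=> k_diff.
have -> : (fun y => dotv a (k y)) = \sum_(i < m) a ord0 i *: Defs.comp k i.
  by apply/funext => y; rewrite fct_sumE.
have -> : dotv (\sum_(i < m) a ord0 i *: grad (Defs.comp k i) x)
        = \sum_(i < m) a ord0 i *: ('d (Defs.comp k i) x : 'rV[R]_n -> R).
  apply/funext => u; rewrite fct_sumE dotv_suml; apply: eq_bigr => i _.
  by rewrite dotvZl -diffE_grad.
elim/big_ind2 : _ => [|F dF G dG FdF GdG|i _].
- exact: is_diff_cst.
- exact: is_diffD.
- by apply: is_diffZ; exact: differentiableP.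
Qed.

Lemma lagrangian_is_diff (x : 'rV[R]_n) :
  is_diff x (lagrangian f g h lambda mu) (dotv (grad_lagrangian x)).
Proof.
have -> : dotv (grad_lagrangian x)
    = ('d f x : 'rV[R]_n -> R)
      + dotv (\sum_(i < p) lambda ord0 i *: grad (Defs.comp g i) x)
      + dotv (\sum_(j < q) mu ord0 j *: grad (Defs.comp h j) x).
  by apply/funext => u; rewrite /grad_lagrangian !dotvDl -diffE_grad addrA.
apply: is_diffD; last exact: dotv_comp_is_diff.
by apply: is_diffD; [exact: differentiableP|exact: dotv_comp_is_diff].
Qed.

Lemma grad_lagrangianE : grad (lagrangian f g h lambda mu) = grad_lagrangian.
Proof.
by apply/funext => x; apply: (grad_unique _ _ _ _ (lagrangian_is_diff x)).
Qed.

End lagrangian_gradient.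

(** * Gradients that are Lipschitz near a point, in the Euclidean norm *)

Definition lipschitz_near {R : realType} {n : nat} (x : 'rV[R]_n)
    (F : 'rV[R]_n -> 'rV[R]_n) : Prop :=
  exists K r : R, [/\ 0 <= K, 0 < r &
    forall y z, enorm (y - x) < r -> enorm (z - x) < r ->
      enorm (F y - F z) <= K * enorm (y - z)].

Section lipschitz_near.
Context {R : realType} {n : nat}.
Implicit Types (x : 'rV[R]_n) (F G : 'rV[R]_n -> 'rV[R]_n).

Lemma lipschitz_near0 x : lipschitz_near x (fun=> 0).
Proof.
by exists 0, 1; split => // y z _ _; rewrite subrr enorm0 mul0r.
Qed.

Lemma lipschitz_nearD x F G : lipschitz_near x F -> lipschitz_near x G ->
  lipschitz_near x (fun y => F y + G y).
Proof.
move=> [K [r [K0 r0 FK]]] [K' [r' [K'0 r'0 GK]]].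
exists (K + K'), (Num.min r r'); split; rewrite ?addr_ge0 ?lt_min ?r0//.
move=> y z; rewrite !lt_min => /andP[yr yr'] /andP[zr zr'].
rewrite opprD addrACA (le_trans (ler_enormD _ _))// mulrDl lerD//.
- exact: FK.
- exact: GK.
Qed.

Lemma lipschitz_nearZ x k F : lipschitz_near x F ->
  lipschitz_near x (fun y => k *: F y).
Proof.
move=> [K [r [K0 r0 FK]]]; exists (`|k| * K), r; split; rewrite ?mulr_ge0//.
by move=> y z yr zr; rewrite -scalerBr enormZ -mulrA ler_wpM2l// FK.
Qed.

Lemma lipschitz_near_sum x (I : Type) (s : seq I)
    (F : I -> 'rV[R]_n -> 'rV[R]_n) :
  (forall i, lipschitz_near x (F i)) ->
  lipschitz_near x (fun y => \sum_(i <- s) F i y).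
Proof.
move=> FL; elim: s => [|i s IH].
  by under eq_fun do rewrite big_nil; exact: lipschitz_near0.
by under eq_fun do rewrite big_cons; exact: lipschitz_nearD.
Qed.

Lemma C11_around_lipschitz_near (f : 'rV[R]_n -> R) x :
  C11_around f x -> lipschitz_near x (grad f).
Proof.
move=> [U [_ Ux _ /(_ x Ux)[V /nbhs_enormP[r r0 rV]]]].
(* The library's Lipschitz predicate holds for every constant beyond some M, and |M| + 1 is one of
   them. The factor n below pays for the change of norms. *)
move=> -[M [_ /(_ (`|M| + 1))]]; rewrite (le_lt_trans (ler_norm _)) ?ltrDl//.
move=> /(_ isT) Vlip.
exists (n%:R * (`|M| + 1)), r; split => //.
move=> y z /rV Vy /rV Vz; rewrite (le_trans (enorm_le_norm _))//.
rewrite -mulrA ler_wpM2l// (le_trans (Vlip (y, z) _))//=.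
by rewrite ler_wpM2l ?addr_ge0// norm_le_enorm.
Qed.

End lipschitz_near.

(** * Expansions and limits *)

Lemma differentiable_expansion {R : realType} {n : nat} (psi : 'rV[R]_n -> R)
    (x : 'rV[R]_n) (e : R) : differentiable psi x -> 0 < e ->
  \forall y \near x,
    `|psi y - psi x - dotv (grad psi x) (y - x)| <= e * `|y - x|.
Proof.
move=> /diff_locallyP[_ /eqadd_some_oP H] e0.
have y0 : y - x @[y --> x] --> (0 : 'rV[R]_n).
  rewrite -(subrr x); apply: (@cvgB _ _ _ (nbhs x)); first exact: cvg_id.
  exact: cvg_cst.
near=> y.
have : `|(psi \o shift x - (cst (psi x) + 'd psi x)) (y - x)| <= e * `|y - x|.
  by near: y; exact: (y0 _ (H e e0)).
by rewrite -diffE_grad !fctE/= subrK opprD addrA.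
Unshelve. all: by end_near. Qed.

(** The first-order remainder at x + t v is o(t |v|), and the directions [v k] are bounded, so
    division by [t k] leaves only <grad psi x, v k> in the limit. *)
Lemma directional_limit {R : realType} {n : nat} (psi : 'rV[R]_n -> R)
    (x u : 'rV[R]_n) (t : nat -> R) (v : nat -> 'rV[R]_n) :
  differentiable psi x -> (forall k, 0 < t k) -> t @ \oo --> (0 : R) ->
  v @ \oo --> u ->
  (psi (x + t k *: v k) - psi x) / t k @[k --> \oo] --> dotv (grad psi x) u.
Proof.
move=> psi_diff t0 t_cvg v_cvg.
have x_cvg : x + t k *: v k @[k --> \oo] --> x.
  rewrite -[X in _ --> X]addr0 -(scale0r u).
  by apply: cvgD; [exact: cvg_cst|exact: cvgZ].
rewrite -[X in _ --> X](subrK (dotv (grad psi x) u)) subrr.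
have -> : (fun k => (psi (x + t k *: v k) - psi x) / t k)
    = (fun k => ((psi (x + t k *: v k) - psi x) / t k - dotv (grad psi x) (v k))
                + dotv (grad psi x) (v k)).
  by apply/funext => k; rewrite subrK.
apply: cvgD; last by apply: dotv_cvg => //; exact: cvg_cst.
apply/cvgrPdist_le => e e0.
have u1 : 0 < `|u| + 1 by rewrite ltr_wpDl.
have eu : 0 < e / (`|u| + 1) by rewrite divr_gt0.
near=> k; rewrite sub0r normrN.
have : `|psi (x + t k *: v k) - psi x
    - dotv (grad psi x) (x + t k *: v k - x)| <=
    e / (`|u| + 1) * `|x + t k *: v k - x|.
  by near: k; exact: (x_cvg _ (differentiable_expansion psi x _ psi_diff eu)).
have -> : x + t k *: v k - x = t k *: v k by rewrite addrC addKr.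
have vk : `|v k| <= `|u| + 1.
  by near: k; apply: (cvgr_le `|u|); [exact: cvg_norm|rewrite ltrDl].
rewrite dotvZr normrZ (gtr0_norm (t0 k)).
set Q := psi _ - psi x; set d := dotv _ _ => Q_le.
have -> : Q / t k - d = (Q - t k * d) / t k.
  by field; rewrite gt_eqF.
rewrite normrM normfV (gtr0_norm (t0 k)) ler_pdivrMr// (le_trans Q_le)//.
rewrite mulrCA mulrC ler_pM2r//.
by rewrite mulrAC ler_pdivrMr// ler_pM2l.
Unshelve. all: by end_near. Qed.

(** Subtracting from [psi] along the segment its linear part and the parabola e / 2 tau^2 leaves a
    function with a smaller value at t than at 0. Its derivative is therefore negative at some
    interior tau, which is the claim. *)
Lemma second_order_mean_value {R : realType} {n : nat} (psi : 'rV[R]_n -> R)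
    (x u : 'rV[R]_n) (t e : R) :
  (forall y, differentiable psi y) -> 0 < t ->
  psi (x + t *: u) < psi x + t * dotv (grad psi x) u + e / 2 * t ^+ 2 ->
  exists2 tau, 0 < tau < t &
    dotv u (grad psi (x + tau *: u)) - dotv u (grad psi x) < e * tau.
Proof.
move=> psi_diff t0 psi_lt.
pose theta (tau : R) :=
  psi (x + tau *: u) - dotv (grad psi x) u * tau - e / 2 * tau ^+ 2.
pose dtheta (tau : R) :=
  dotv (grad psi (x + tau *: u)) u - dotv (grad psi x) u - e * tau.
have theta_drv (tau : R) : is_derive tau 1 theta (dtheta tau).
  have line_diff :
      is_diff tau (fun tau : R => x + tau *: u) (fun s : R => s *: u).
    by apply: is_diff_eq; apply/funext => s; rewrite /= fctE add0r.
  have comp_drv : is_derive tau 1 (fun tau : R => psi (x + tau *: u))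
      (dotv (grad psi (x + tau *: u)) u).
    have cd := is_diff_comp line_diff
      (differentiableP (psi_diff (x + tau *: u))).
    apply: DeriveDef; first by apply: diff_derivable; exact: ex_diff.
    by rewrite deriveE ?diff_val//= scale1r diffE_grad.
  rewrite /theta; apply: is_derive_eq; rewrite /dtheta.
  have alg (a b : R) :
      a - b%:A - (e / 2) *: (tau%:A + tau%:A) = a - b - e * tau.
    have scaleE (c d : R) : c *: d = c * d by [].
    by rewrite !scaleE !mulr1; field.
  exact: alg.
have theta_cont : {within `[0, t], continuous theta}.
  by apply: derivable_within_continuous => tau _; exact: ex_derive.
have [tau] := MVT t0 (fun tau _ => theta_drv tau) theta_cont.
rewrite in_itv/= => tau_t; rewrite /theta scale0r addr0 subr0 => thetaE.
exists tau => //.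
rewrite -subr_lt0 [X in X - _ - _]dotvC [X in _ - X - _]dotvC.
have : dtheta tau * t < 0 by rewrite -thetaE; lra.
by rewrite pmulr_llt0.
Qed.

(** Compactness gives a cluster point l; [sigma k] is an index from k on whose term lies within 1 /
    (k + 1) of l. The bound [k <= sigma k] already makes [sigma] tend to infinity, so limits pass to
    the reindexed sequence. *)
Lemma bounded_subsequence {R : realType} {n : nat} (x : nat -> 'rV[R]_n)
    (M : R) : (forall k, `|x k| <= M) ->
  exists (l : 'rV[R]_n) (sigma : nat -> nat),
    (forall k, (k <= sigma k)%N) /\ x \o sigma @ \oo --> l.
Proof.
move=> xM; pose A := [set y : 'rV[R]_n | `|y| <= M].
have A_closed : closed A.
  apply: (@preimage_closed _ _ (fun y : 'rV[R]_n => `|y|) [set c | c <= M]).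
    by move=> y _; exact: norm_continuous.
  exact: closed_le.
have A_compact : compact A by exact: (norm_le_compact A M A_closed).
have xA : (x @ \oo) A by exists 0%N => // k _; exact: xM.
have [l [_ l_cluster]] := A_compact (x @ \oo) _ xA.
have near_l k : exists j, (k <= j)%N /\ `|l - x j| < k.+1%:R^-1.
  have tail : (x @ \oo) [set x j | j in [set j | (k <= j)%N]].
    by exists k => // j /= kj; exists j.
  have lball : nbhs l (ball l (k.+1%:R^-1 : R)).
    by apply: nbhsx_ballx; rewrite invr_gt0.
  have [_ [[j /= kj <-]]] := l_cluster _ _ tail lball.
  by rewrite mx_norm_ball /ball_/=; exists j.
have [sigma sigmaP] := choice near_l.
exists l, sigma; split=> [k|]; first by have [] := sigmaP k.
apply/cvgrPdist_lt => e e0; near=> k.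
have [_ /= /lt_trans] := sigmaP k; apply.
by near: k; exact: (near_infty_natSinv_lt (PosNum e0)).
Unshelve. all: by end_near. Qed.

Lemma subsequence_cvg (sigma : nat -> nat) : (forall k, (k <= sigma k)%N) ->
  sigma @ \oo --> \oo.
Proof.
move=> sigma_ge; apply/cvgnyPge => A; near=> k.
by apply: leq_trans (sigma_ge k); near: k; exact: nbhs_infty_ge.
Unshelve. all: by end_near. Qed.

(* Supports can only grow near [x], so for sparse y close to [x] the whole line
   through [x] and y is sparse, and the o(.) in the definition of normality
   disappears along it. *)
Lemma sparse_normal_le0 {R : realType} {n s : nat} (x v : 'rV[R]_n) :
  frechet_normal (sparse s) x v ->
  \forall y \near x, sparse s y -> dotv v (y - x) <= 0.
Proof.
move=> /frechet_normalP v_normal.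
have supp_near : \forall y \near x,
    forall i, x ord0 i != 0 -> (y : 'rV[R]_n) ord0 i != 0.
  apply: (@filter_forall _ _ _ (nbhs x)) => i.
  have [xi0|xi0] := eqVneq (x ord0 i) 0; first exact: (@nearW _ (nbhs x)).
  near=> y => _; near: y; apply: (@cvgr_neq0 _ _ _ (nbhs x) _ _ (x ord0 i)) => //.
  exact: coord_continuous.
near=> y => y_sparse.
have supp_y : forall i, x ord0 i != 0 -> y ord0 i != 0 by near: y.
have seg_sparse h : sparse s (x + h *: (y - x)).
  rewrite /sparse/= (leq_trans _ y_sparse)//; apply: subset_leq_card.
  apply/fintype.subsetP => i; rewrite !inE !mxE; apply: contra => /eqP yi0.
  have /eqP -> : x ord0 i == 0.
    by apply/negPn/negP => /supp_y; rewrite yi0 eqxx.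
  by rewrite yi0 subrr mulr0 addr0.
have v_le e : 0 < e -> dotv v (y - x) <= e * enorm (y - x).
  (* The normality estimate is used at a single small h > 0; it is homogeneous in h, so h
     cancels. *)
  move=> e0; have [h] : exists h : R, 0 < h /\
      (sparse s (x + h *: (y - x)) -> dotv v (x + h *: (y - x) - x) <=
        e * enorm (x + h *: (y - x) - x)).
    apply: (@filter_ex _ (0 : R)^'+); near=> h; split.
      by near: h; exact: nbhs_right_gt.
    by near: h; exact: (line_cvg x (y - x) _ (v_normal e e0)).
  move=> [h0 /(_ (seg_sparse h))].
  have -> : x + h *: (y - x) - x = h *: (y - x) by rewrite addrC addKr.
  by rewrite dotvZr enormZ (gtr0_norm h0) mulrCA ler_pM2l.
apply/ler_addgt0Pr => e e0; rewrite add0r.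
(* Adding 1 avoids a zero divisor when y = x. *)
have d0 : 0 < enorm (y - x) + 1 by rewrite ltr_wpDl// enorm_ge0.
have /v_le/le_trans : 0 < e / (enorm (y - x) + 1) by rewrite divr_gt0.
apply; rewrite mulrAC ler_pdivrMr// ler_pM2l//; lra.
Unshelve. all: by end_near. Qed.

Lemma row_mx_cvg {R : realType} {n m : nat} (T : Type) (F : set_system T)
    {FF : Filter F} (a : T -> 'rV[R]_n) (b : T -> 'rV[R]_m)
    (x : 'rV[R]_n) (y : 'rV[R]_m) :
  a @ F --> x -> b @ F --> y -> row_mx (a t) (b t) @[t --> F] --> row_mx x y.
Proof.
move=> /cvg_ballP ax /cvg_ballP by_; apply/cvg_ballP => e e0; near=> t.
have [_ at_] : ball x e (a t) by near: t; exact: ax.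
have [_ bt] : ball y e (b t) by near: t; exact: by_.
by split=> // i j; rewrite !mxE; case: splitP => k _; [exact: at_|exact: bt].
Unshelve. all: by end_near. Qed.

(** Two mean value arguments are chained: along the segment for [psi], then the fuzzy one for <u,
    grad psi>. The bound [K] is the local Lipschitz constant, chosen before e, so the vectors w stay
    bounded as e tends to 0. *)
Lemma small_coderivative {R : realType} {n : nat} (psi : 'rV[R]_n -> R)
    (x : 'rV[R]_n) :
  (forall y, differentiable psi y) -> continuous (grad psi) ->
  lipschitz_near x (grad psi) ->
  exists2 K : R, 0 <= K & forall e : R, 0 < e ->
    exists2 delta : R, 0 < delta & forall t u, 0 < t < delta -> enorm u = 1 ->
      psi (x + t *: u) < psi x + t * dotv (grad psi x) u + e / 4 * t ^+ 2 ->
      exists y w, [/\ enorm (y - x) < e, enorm w <= K, dotv w u <= e &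
        frechet_normal (graph (grad psi)) (row_mx y (grad psi y))
          (row_mx w (- u))].
Proof.
move=> psi_diff grad_cont [K [r0 [K0 r0_gt0 grad_lip]]].
exists K => // e e0.
(* The bound e keeps y close to x; r0 / 2 keeps the closed ball of radius r inside the region where
   the gradient is Lipschitz. *)
pose r := Num.min e (r0 / 2).
have r_gt0 : 0 < r by rewrite lt_min e0 divr_gt0.
have r_lt : r < r0.
  by rewrite gt_min; apply/orP; right; rewrite ltr_pdivrMr// ltr_pMr// ltr1n.
have Ke : 0 < 2 * (K + e) by rewrite mulr_gt0// ltr_wpDl.
(* The second bound gives 2 (K + e) tau <= e r, as the fuzzy mean value inequality requires with A =
   e and T = tau. *)
exists (Num.min r (e * r / (2 * (K + e)))).
  by rewrite lt_min r_gt0 divr_gt0// mulr_gt0.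
move=> t u /andP[t0]; rewrite lt_min => /andP[tr].
rewrite ltr_pdivlMr// => tKe u1 psi_lt.
(* Halving twice: the segment argument with e / 2 yields an increment of <u, grad psi> below e / 2 *
   tau, the form needed next. *)
have {}psi_lt : psi (x + t *: u) <
    psi x + t * dotv (grad psi x) u + e / 2 / 2 * t ^+ 2.
  by apply: (lt_le_trans psi_lt); lra.
have [tau /andP[tau0 taut] phi_lt] := second_order_mean_value _ _ _ _ _
  psi_diff t0 psi_lt.
pose phi y := dotv u (grad psi y).
have phi_cont : continuous phi.
  move=> y; apply: (@dotv_cvg _ _ _ (nbhs y) _ (fun=> u) (grad psi)).
    exact: cvg_cst.
  exact: grad_cont.
have phi_lip y z : enorm (y - x) < r0 -> enorm (z - x) < r0 ->
    `|phi y - phi z| <= K * enorm (y - z).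
  move=> yr zr; rewrite /phi -dotvBr (le_trans (dotv_le_enorm _ _))//.
  by rewrite u1 mul1r grad_lip.
have x0 : enorm (x - x) < r0 by rewrite subrr enorm0.
have [|||y [w [yr wu prox]]] :=
    fuzzy_mean_value phi x u K r e tau u1 K0 e0 _ _ phi_cont _ phi_lt.
- by rewrite tau0 (le_trans (ltW taut) (ltW tr)).
- by rewrite (le_trans _ (ltW tKe))// mulrC ler_pM2r// ltW.
- move=> y yr; apply: ler_distlCBl.
  exact: phi_lip (le_lt_trans yr r_lt) x0.
exists y, w; split=> //.
- by rewrite (lt_le_trans yr)// ge_min lexx.
- apply: (proximal_subgradient_norm_le phi y) => //.
  have gap : 0 < r0 - enorm (y - x) by rewrite subr_gt0 (lt_trans yr).
  near=> z.
  have zr : enorm (z - x) < r0.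
    rewrite -(subrK y z) -addrA (le_lt_trans (ler_enormD _ _))// -ltrBrDr.
    by near: z; exact: near_enorm_lt.
  apply: ler_distlDr; exact: phi_lip zr (lt_trans yr r_lt).
- exact: proximal_subgradient_frechet_normal.
Unshelve. all: by end_near. Qed.

(** * The sufficient condition *)

(** Failure is tested with the constant c = 2 e on the Euclidean ball of radius e, so one parameter
    controls both the distance and the quadratic coefficient. *)
Lemma not_isolated_direction {R : realType} {n : nat} (f : 'rV[R]_n -> R)
    (Omega : set 'rV[R]_n) (x : 'rV[R]_n) (e : R) :
  Omega x -> ~ isolated_local_solution2 f Omega x -> 0 < e ->
  exists t u, [/\ 0 < t < e, enorm u = 1, Omega (x + t *: u) &
    f (x + t *: u) < f x + e * t ^+ 2].
Proof.
move=> Ox noniso e0; apply: contrapT => no_dir; apply: noniso; split => //.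
exists (2 * e); split; first by rewrite mulr_gt0.
exists [set y | enorm (y - x) < e]; split; first exact: near_enorm_lt.
move=> y [Oy /= ye]; rewrite mulKf//.
have [->|yx] := eqVneq y x.
  by rewrite subrr enorm0 expr0n mulr0 addr0.
have t0 : 0 < enorm (y - x) by rewrite enorm_gt0// subr_eq0.
rewrite leNgt; apply/negP => f_lt; apply: no_dir.
have yE : x + enorm (y - x) *: ((enorm (y - x))^-1 *: (y - x)) = y.
  by rewrite scalerA divff ?gt_eqF// scale1r addrC subrK.
exists (enorm (y - x)), ((enorm (y - x))^-1 *: (y - x)).
rewrite yE t0 ye; split=> //.
by rewrite enormZ normfV (gtr0_norm t0) mulVf// gt_eqF.
Qed.

(** * The Lagrangian on feasible points, and critical directions *)

Section lagrangian_values.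
Context {R : realType} {n p q : nat}.
Variables (f : 'rV[R]_n -> R) (g : 'rV[R]_n -> 'rV[R]_p)
  (h : 'rV[R]_n -> 'rV[R]_q) (lambda : 'rV[R]_p) (mu : 'rV[R]_q).
Hypothesis lambda_ge0 : forall i, 0 <= lambda ord0 i.

Lemma dotv_mu_feasible x : feasible g h x -> dotv mu (h x) = 0.
Proof.
move=> [_ hx]; apply: big1 => j _.
by have := hx j; rewrite /Defs.comp => ->; rewrite mulr0.
Qed.

Lemma lagrangian_le x : feasible g h x -> lagrangian f g h lambda mu x <= f x.
Proof.
move=> gh_x; rewrite /lagrangian dotv_mu_feasible// addr0 gerDl.
by apply: sumr_le0 => i _; rewrite mulr_ge0_le0//; exact: gh_x.1.
Qed.

Lemma lagrangian_complementary x : feasible g h x ->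
  (forall i, lambda ord0 i * Defs.comp g i x = 0) ->
  lagrangian f g h lambda mu x = f x.
Proof.
move=> gh_x compl; rewrite /lagrangian dotv_mu_feasible// addr0.
by rewrite [dotv _ _]big1 ?addr0// => i _; exact: compl.
Qed.

(** The constraints pass to the limit in difference quotients. For f, the bound t^2 gives <grad f,
    u> <= 0, and the sign of the Lagrangian derivative gives the reverse inequality. *)
Lemma limit_direction_critical (x u : 'rV[R]_n) (t : nat -> R)
    (v : nat -> 'rV[R]_n) :
  differentiable f x -> (forall i, differentiable (Defs.comp g i) x) ->
  (forall j, differentiable (Defs.comp h j) x) ->
  (forall i, lambda ord0 i * Defs.comp g i x = 0) ->
  feasible g h x -> (forall k, feasible g h (x + t k *: v k)) ->
  (forall k, 0 < t k) -> t @ \oo --> (0 : R) -> v @ \oo --> u ->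
  (forall k, f (x + t k *: v k) <= f x + t k * t k) ->
  0 <= dotv (grad_lagrangian f g h lambda mu x) u ->
  critical_cone f g h x u.
Proof.
move=> f_diff g_diff h_diff compl gh_x gh_t t0 t_cvg v_cvg f_le L_ge0.
have lim_of psi (psi_diff : differentiable psi x) :=
  directional_limit psi x u t v psi_diff t0 t_cvg v_cvg.
have g_le0 i : active g x i -> dotv (grad (Defs.comp g i) x) u <= 0.
  move=> gi0; apply: (ler_cvg_to (lim_of _ (g_diff i)) (cvg_cst 0)).
  apply: nearW => k; rewrite (_ : Defs.comp g i x = 0)// subr0.
  rewrite ler_pdivrMr// mul0r; exact: (gh_t k).1.
have h_eq0 j : dotv (grad (Defs.comp h j) x) u = 0.
  have := lim_of _ (h_diff j).
  rewrite (_ : (fun k => _) = cst 0) => [h_cvg|].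
    exact: (cvg_unique _ h_cvg (cvg_cst 0)).
  by apply/funext => k; rewrite (gh_t k).2 gh_x.2 subrr mul0r.
split=> //; apply/eqP; rewrite eq_le; apply/andP; split.
  apply: (ler_cvg_to (lim_of _ f_diff) t_cvg); apply: nearW => k.
  by rewrite ler_pdivrMr// lerBlDl.
(* The equality terms vanish and the inequality terms are nonpositive: active ones by sign, inactive
   ones because their multiplier is zero. *)
apply: le_trans L_ge0 _; rewrite /grad_lagrangian !dotvDl !dotv_suml.
rewrite [X in _ + (_ + X)]big1 => [|j _]; last by rewrite dotvZl h_eq0 mulr0.
rewrite addr0 gerDl; apply: sumr_le0 => i _; rewrite dotvZl.
have [gi0|gi_neq0] := eqVneq (Defs.comp g i x) 0.
  by rewrite mulr_ge0_le0// g_le0.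
have /eqP := compl i; rewrite mulf_eq0 (negbTE gi_neq0) orbF => /eqP ->.
by rewrite mul0r.
Qed.

End lagrangian_values.

Lemma continuous_grad_lagrangian {R : realType} {n p q : nat}
    (f : 'rV[R]_n -> R) (g : 'rV[R]_n -> 'rV[R]_p) (h : 'rV[R]_n -> 'rV[R]_q)
    (lambda : 'rV[R]_p) (mu : 'rV[R]_q) :
  C1 f -> C1_vec g -> C1_vec h ->
  continuous (grad_lagrangian f g h lambda mu).
Proof.
move=> [_ fc] gc hc x.
have sum_cont m (k : 'rV[R]_n -> 'rV[R]_m) (a : 'rV[R]_m) : C1_vec k ->
    continuous (fun y => \sum_(i < m) a ord0 i *: grad (Defs.comp k i) y).
  move=> kc; apply: continuous_big => [|i _ y]; first exact: add_continuous.
  apply: (@cvgZl_tmp _ _ _ (nbhs y)); exact: (kc i).2.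
apply: (@cvgD _ _ _ (nbhs x)); first exact: fc.
by apply: (@cvgD _ _ _ (nbhs x)); exact: sum_cont.
Qed.

Lemma lipschitz_near_grad_lagrangian {R : realType} {n p q : nat}
    (f : 'rV[R]_n -> R) (g : 'rV[R]_n -> 'rV[R]_p) (h : 'rV[R]_n -> 'rV[R]_q)
    (lambda : 'rV[R]_p) (mu : 'rV[R]_q) (x : 'rV[R]_n) :
  C11_around f x -> C11_vec_around g x -> C11_vec_around h x ->
  lipschitz_near x (grad_lagrangian f g h lambda mu).
Proof.
move=> fL gL hL; apply: lipschitz_nearD.
  exact: C11_around_lipschitz_near.
apply: lipschitz_nearD; apply: lipschitz_near_sum => i; apply: lipschitz_nearZ.
  exact: (C11_around_lipschitz_near _ _ (gL i)).
exact: (C11_around_lipschitz_near _ _ (hL i)).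
Qed.

Theorem theorem4p1 (R : realType) (n p q s : nat)
    (f : 'rV[R]_n -> R) (g : 'rV[R]_n -> 'rV[R]_p) (h : 'rV[R]_n -> 'rV[R]_q)
    (xbar : 'rV[R]_n) (lambda : 'rV[R]_p) (mu : 'rV[R]_q) :
  (0 < s < n)%N ->
  C1 f -> C1_vec g -> C1_vec h ->
  (feasible g h `&` sparse s) xbar ->
  C11_around f xbar -> C11_vec_around g xbar -> C11_vec_around h xbar ->
  S_stationary s f g h xbar ->
  multipliersS s f g h xbar (lambda, mu) ->
  (forall u : 'rV[R]_n,
     ((contingent_cone (feasible g h `&` sparse s) xbar
       `&` critical_cone f g h xbar) `\` [set 0]) u ->
     forall z : 'rV[R]_n,
       subdiff2 (lagrangian f g h lambda mu) xbar u z -> 0 < dotv z u) ->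
  isolated_local_solution2 f (feasible g h `&` sparse s) xbar.
Proof.
move=> _ fC gC hC Ox fC11 gC11 hC11 _ [/= lambda_ge0 L_normal compl].
move=> second_order.
apply: contrapT => noniso.
have f_diff := fC.1; have g_diff i := (gC i).1; have h_diff j := (hC j).1.
have gradL := grad_lagrangianE f g h lambda mu f_diff g_diff h_diff.
have L_diff y : differentiable (lagrangian f g h lambda mu) y.
  have := lagrangian_is_diff f g h lambda mu f_diff g_diff h_diff y.
  by move=> Ly; exact: ex_diff.
have gradL_cont := continuous_grad_lagrangian f g h lambda mu fC gC hC.
have gradL_lip := lipschitz_near_grad_lagrangian f g h lambda mu xbar
  fC11 gC11 hC11.
have L_xbar := lagrangian_complementary f g h lambda mu xbar Ox.1 compl.
have L_le := lagrangian_le f g h lambda mu lambda_ge0.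
have := small_coderivative (lagrangian f g h lambda mu) xbar L_diff.
move: L_normal second_order; rewrite /subdiff2 gradL.
set F := grad_lagrangian f g h lambda mu in gradL_cont gradL_lip *.
move=> /sparse_normal_le0 /nbhs_enormP[r r0 L_normal] second_order.
move=> /(_ gradL_cont gradL_lip) [K K0 small_cod].
(* All the data found at scale 1 / (m + 1), gathered in one predicate so that a single choice
   produces the four sequences. *)
pose good (m : nat) (c : R * 'rV[R]_n * ('rV[R]_n * 'rV[R]_n)) :=
  let: (t, u, (y, w)) := c in
  [/\ [/\ 0 < t, t < m.+1%:R^-1, enorm u = 1,
          (feasible g h `&` sparse s) (xbar + t *: u) &
          f (xbar + t *: u) <= f xbar + t * t],
      0 <= dotv (F xbar) u &
      [/\ enorm (y - xbar) < m.+1%:R^-1, enorm w <= K,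
          dotv w u <= m.+1%:R^-1 &
          frechet_normal (graph F) (row_mx y (F y)) (row_mx w (- u))]].
have good_ex m : exists c, good m c.
  have e0 : 0 < m.+1%:R^-1 :> R by rewrite invr_gt0.
  have e1 : m.+1%:R^-1 <= 1 :> R by rewrite invf_le1// ler1n.
  rewrite /good; move: (m.+1%:R^-1 : R) e0 e1 => e e0 e1.
  have e4_lt : e / 4 < e by lra.
  have e4_le1 : e / 4 <= 1 by lra.
  have [delta delta0 delta_cod] := small_cod e e0.
  (* The bound e / 4 limits the quadratic coefficient and makes t < e; [delta] serves the
     coderivative estimate and r the sign of <F xbar, u>. *)
  pose d := Num.min (e / 4) (Num.min delta r).
  have d0 : 0 < d by rewrite !lt_min delta0 r0 divr_gt0.
  have [t [u [/andP[t0 td] u1 Ot f_lt]]] :=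
    not_isolated_direction f _ xbar d Ox noniso d0.
  move: td; rewrite !lt_min => /and3P[te tdelta tr].
  have de : d <= e / 4 by rewrite ge_min lexx.
  have tuE : xbar + t *: u - xbar = t *: u by rewrite addrC addKr.
  have Fu : 0 <= dotv (F xbar) u.
    have := L_normal (xbar + t *: u).
    rewrite tuE enormZ u1 mulr1 (gtr0_norm t0).
    move=> /(_ tr Ot.2); rewrite dotvNl dotvZr oppr_le0.
    by rewrite pmulr_rge0.
  have f_lt4 : f (xbar + t *: u) < f xbar + e / 4 * t ^+ 2.
    by rewrite (lt_le_trans f_lt)// lerD2l ler_pM2r// exprn_gt0.
  (* The Lagrangian is at most f at the new point and equals f at [xbar]; the added linear term is
     nonnegative by [Fu]. *)
  have L_lt : lagrangian f g h lambda mu (xbar + t *: u) <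
      lagrangian f g h lambda mu xbar + t * dotv (F xbar) u + e / 4 * t ^+ 2.
    rewrite L_xbar (le_lt_trans (L_le _ Ot.1))// (lt_le_trans f_lt4)//.
    by rewrite lerD2r lerDl mulr_ge0// ltW.
  have t_lt : 0 < t < delta by rewrite t0.
  have [y [w [ye wK wu normal]]] := delta_cod t u t_lt u1 L_lt.
  have te' : t < e by exact: lt_trans te e4_lt.
  have f_le : f (xbar + t *: u) <= f xbar + t * t.
    by rewrite (le_trans (ltW f_lt4))// lerD2l -expr2 ler_piMl ?sqr_ge0.
  by exists (t, u, (y, w)).
have [c c_good] := choice good_ex.
pose t k := (c k).1.1; pose u k := (c k).1.2.
pose y k := (c k).2.1; pose w k := (c k).2.2.
have {}c_good k : good k (t k, u k, (y k, w k)).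
  by have := c_good k; rewrite /t /u /y /w; case: (c k) => [[? ?] [? ?]].
(* Stacking u and w lets one extraction give a common subsequence; 1 + |w|^2 <= (1 + K)^2. *)
have uw_bounded k : `|row_mx (u k) (w k)| <= 1 + K.
  have [[_ _ u1 _ _] _ [_ wK _ _]] := c_good k.
  apply: le_trans (norm_le_enorm _) _.
  rewrite -(@ler_pXn2r _ 2)// ?nnegrE ?addr_ge0 ?enorm_ge0//.
  rewrite sqr_enorm dotv_row_mx -!sqr_enorm u1.
  have : enorm (w k) ^+ 2 <= K ^+ 2 by rewrite ler_pXn2r// nnegrE enorm_ge0.
  rewrite sqrrD; move: (enorm _ ^+ 2) => b; lra.
have [l [sigma [sigma_ge l_cvg]]] := bounded_subsequence _ _ uw_bounded.
have sigma_cvg := subsequence_cvg sigma sigma_ge.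
have inv_cvg : (sigma k).+1%:R^-1 @[k --> \oo] --> (0 : R).
  exact: (cvg_comp _ _ sigma_cvg (@cvg_harmonic R)).
pose ub := lsubmx l; pose z := rsubmx l.
have u_cvg : u (sigma k) @[k --> \oo] --> ub.
  have := cvg_comp _ _ l_cvg (@continuous_lsubmx R 1 n n l).
  by under eq_cvg do rewrite /= row_mxKl.
have w_cvg : w (sigma k) @[k --> \oo] --> z.
  have := cvg_comp _ _ l_cvg (@continuous_rsubmx R 1 n n l).
  by under eq_cvg do rewrite /= row_mxKr.
have t_cvg : t (sigma k) @[k --> \oo] --> (0 : R).
  apply: (squeeze_cvgr _ (cvg_cst 0) inv_cvg); apply: nearW => k.
  by have [[t0 /ltW tk _ _ _] _ _] := c_good (sigma k); rewrite ltW.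
have y_cvg : y (sigma k) @[k --> \oo] --> xbar.
  apply/cvgrPdist_lt => e e0; near=> k.
  have [_ _ [yk _ _ _]] := c_good (sigma k).
  rewrite distrC (le_lt_trans (norm_le_enorm _))// (lt_trans yk)//.
  by near: k; exact: (cvgr_lt 0 inv_cvg).
have F_ge0 : 0 <= dotv (F xbar) ub.
  have Fu_cvg : dotv (F xbar) (u (sigma k)) @[k --> \oo] --> dotv (F xbar) ub.
    exact: (dotv_cvg _ _ (cst (F xbar)) (u \o sigma) _ _ (cvg_cst _) u_cvg).
  apply: (ler_cvg_to (cvg_cst 0) Fu_cvg); apply: nearW => k.
  by have [] := c_good (sigma k).
(* The unit length survives in the limit, so [ub] is nonzero. *)
have ub1 : dotv ub ub = 1.
  have uu_cvg : dotv (u (sigma k)) (u (sigma k)) @[k --> \oo] --> dotv ub ub.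
    exact: (dotv_cvg _ _ (u \o sigma) (u \o sigma) _ _ u_cvg u_cvg).
  have uuE : (fun k => dotv (u (sigma k)) (u (sigma k))) = cst 1.
    apply/funext => k; rewrite -sqr_enorm.
    by have [[_ _ -> _ _] _ _] := c_good (sigma k); rewrite expr1n.
  have one_cvg : cst (1 : R) @ \oo --> (1 : R) by exact: cvg_cst.
  rewrite uuE in uu_cvg; exact: (cvg_unique _ uu_cvg one_cvg).
have ub_dir : ((contingent_cone (feasible g h `&` sparse s) xbar
    `&` critical_cone f g h xbar) `\` [set 0]) ub.
  split=> [|/= ub0]; last by move/eqP: ub1; rewrite ub0 dotv0r eq_sym oner_eq0.
  split.
    exists (t \o sigma), (u \o sigma); split; [|exact: t_cvg|exact: u_cvg|].
      by move=> k; have [[]] := c_good (sigma k).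
    by move=> k; have [[]] := c_good (sigma k).
  apply: (limit_direction_critical f g h lambda mu lambda_ge0 xbar ub
    (t \o sigma) (u \o sigma) (f_diff xbar) (fun i => g_diff i xbar)
    (fun j => h_diff j xbar) compl Ox.1 _ _ t_cvg u_cvg _ F_ge0).
  - by move=> k; have [[_ _ _ [gh_k _] _] _ _] := c_good (sigma k).
  - by move=> k; have [[t_gt0 _ _ _ _] _ _] := c_good (sigma k).
  - by move=> k; have [[_ _ _ _ f_k] _ _] := c_good (sigma k).
have z_cod : limiting_normal (graph F) (row_mx xbar (F xbar)) (row_mx z (- ub)).
  exists (fun k => row_mx (y (sigma k)) (F (y (sigma k)))),
    (fun k => row_mx (w (sigma k)) (- u (sigma k))); split.
  - by move=> k; exists (y (sigma k)).
  - apply: row_mx_cvg; first exact: y_cvg.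
    exact: (cvg_comp _ _ y_cvg (gradL_cont xbar)).
  - by move=> k; have [_ _ []] := c_good (sigma k).
  - by apply: row_mx_cvg; [exact: w_cvg|apply: cvgN; exact: u_cvg].
(* Passing to the limit in <w, u> <= 1 / (m + 1) gives <z, ub> <= 0, against the second-order
   condition. *)
have := second_order ub ub_dir z z_cod; apply/negP; rewrite -leNgt.
have wu_cvg : dotv (w (sigma k)) (u (sigma k)) @[k --> \oo] --> dotv z ub.
  exact: (dotv_cvg _ _ (w \o sigma) (u \o sigma) _ _ w_cvg u_cvg).
apply: (ler_cvg_to wu_cvg inv_cvg); apply: nearW => k.
by have [_ _ []] := c_good (sigma k).
Unshelve. all: by end_near. Qed.
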